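(* Let $S^1=\mathbb{R}/2\pi\mathbb{Z}$ be the unit circle and let $\mu_0,\mu_1\in\mathcal{P}(S^1)$, identified with their densities with respect to $\mathrm{d}\theta$. Suppose that, for real coefficients $(a_k)_{k\ge 1}$, $(b_k)_{k\ge 1}$, $$\mu_1=\mu_0+\sum_{k\in\mathbb{Z}^+}\bigl(a_k\cos(k\theta)+b_k\sin(k\theta)\bigr)$$ (the $0$-frequency term vanishes because $\mu_0$ and $\mu_1$ have the same total mass). If $$\nu=\mu_0-\sum_{k\in\mathbb{Z}^+}\Bigl(\bigl(a_k\cos(k\theta)\bigr)^{-}+\bigl(b_k\sin(k\theta)\bigr)^{-}\Bigr)$$ is a non-negative measure on $S^1$, then $$W_2^2(\mu_0,\mu_1)\le\sum_{k\in\mathbb{Z}^+}\frac{2\pi^2}{k^2}\bigl(|a_k|+|b_k|\bigr).$$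
   Context: $\mathbb{Z}^+=\{1,2,3,\dots\}$. $\mathcal{P}(S^1)$ is the set of probability measures on $S^1$ that are absolutely continuous with respect to the Lebesgue measure $\mathrm{d}\theta$ on $[0,2\pi)$; a measure is identified with its density. For a real function (or signed Radon measure) $f$, $f^{-}$ is its negative part, for functions $f^{-}=\max(-f,0)\ge 0$. The quadratic Wasserstein distance on $S^1$ is taken with respect to the geodesic distance: $W_2^2(\mu_0,\mu_1)=\min_{\kappa}\int_{S^1\times S^1}c(\theta,\varphi)\,\mathrm{d}\kappa(\theta,\varphi)$, where the minimum is over all couplings $\kappa$ of $\mu_0$ and $\mu_1$ (probability measures on $S^1\times S^1$ with marginals $\mu_0$ and $\mu_1$), and $c(\theta,\varphi)=\min\bigl(|\theta-\varphi|^2,(2\pi-|\theta-\varphi|)^2\bigr)$ for $\theta,\varphi\in[0,2\pi)$. *)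

(* Defs.v *)
From HB Require Import structures.
From mathcomp Require Import all_boot all_order all_algebra.
From mathcomp Require Import all_classical all_reals all_analysis.

Set Implicit Arguments.
Unset Strict Implicit.
Unset Printing Implicit Defensive.

Import Order.TTheory GRing.Theory Num.Theory.
Import numFieldNormedType.Exports.

Local Open Scope classical_set_scope.
Local Open Scope ring_scope.

(** S^1 = R/2piZ is represented by its fundamental domain [0, 2pi) inside R, and
    a measure on S^1 by a measure on R that is carried by [0, 2pi). *)
Definition circle (R : realType) : set R := `[0, 2 * pi[%classic.

Arguments circle : clear implicits.

Definition ac_circle_probability (R : realType)
    (mu : probability (measurableTypeR R) R) : Prop :=
  mu (~` circle R) = 0%E /\ mu `<< (@lebesgue_measure R).

Definition circle_density (R : realType)
    (mu : probability (measurableTypeR R) R) (f : R -> R) : Prop :=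
  (@lebesgue_measure R).-integrable (circle R) (EFin \o f) /\
  forall A : set (measurableTypeR R), measurable A -> A `<=` circle R ->
    mu A = (\int[@lebesgue_measure R]_(x in A) (f x)%:E)%E.

(** The squared geodesic distance for representatives in [0, 2pi); the values
    off [0, 2pi) x [0, 2pi) are never charged by a coupling. *)
Definition circle_cost (R : realType) (p : R * R) : R :=
  Num.min (`|p.1 - p.2| ^+ 2) ((2 * pi - `|p.1 - p.2|) ^+ 2).

Definition coupling (R : realType) (mu0 mu1 : probability (measurableTypeR R) R)
    (kappa : probability (measurableTypeR R * measurableTypeR R)%type R) : Prop :=
  forall A : set (measurableTypeR R), measurable A ->
    kappa (A `*` setT) = mu0 A /\ kappa (setT `*` A) = mu1 A.

(** The minimum in the Kantorovich problem is attained (the cost is continuous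
    on the compact torus), so it is the infimum of the transport costs. *)
Definition W2sq (R : realType) (mu0 mu1 : probability (measurableTypeR R) R) :
    \bar R :=
  ereal_inf [set (\int[kappa]_p (circle_cost p)%:E)%E |
             kappa in [set kappa | coupling mu0 mu1 kappa]].

Definition cos_mode (R : realType) (a : nat -> R) (k : nat) : R -> R :=
  fun t => a k * cos (k%:R * t).

Definition sin_mode (R : realType) (b : nat -> R) (k : nat) : R -> R :=
  fun t => b k * sin (k%:R * t).

(** The density is [-oo] wherever the series of negative parts diverges. *)
Definition nu_density (R : realType) (f0 : R -> R) (a b : nat -> R) (t : R) :
    \bar R :=
  ((f0 t)%:E -
   \sum_(1 <= k <oo) ((cos_mode a k)^\- t + (sin_mode b k)^\- t)%:E)%E.

Definition nonneg_circle_measure (R : realType) (g : R -> \bar R) : Prop :=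
  forall A : set (measurableTypeR R), measurable A -> A `<=` circle R ->
    (0 <= \int[@lebesgue_measure R]_(t in A) g t)%E.

(* Main.v *)
(** Remove from [mu0] the density [nu], which both measures contain. What is
    left of [mu0] is the sum of the negative parts of the modes, and what is
    left of [mu1] the sum of their positive parts. Rotating the circle by
    [pi / k] changes the sign of every mode of frequency [k], hence carries its
    negative part onto its positive part at squared distance [(pi / k) ^ 2],
    and the mass carried is [2 * |a k|] or [2 * |b k|]. Leaving [nu] in place
    and rotating each negative part gives a coupling whose cost is at most the
    right-hand side. *)
Require Import Defs.
From HB Require Import structures.
From mathcomp Require Import all_boot all_order all_algebra.
From mathcomp Require Import ring lra.
From mathcomp Require Import all_classical all_reals all_analysis.
From mathcomp Require Import measurable_realfun measurable_fun_approximation.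

Set Implicit Arguments.
Unset Strict Implicit.
Unset Printing Implicit Defensive.

Import Order.TTheory GRing.Theory Num.Theory.
Import numFieldNormedType.Exports.

Local Open Scope classical_set_scope.
Local Open Scope ring_scope.

(** * Measures given by a non-negative density on a measurable set *)

Section density_measure.
Local Open Scope ereal_scope.
Context d (T : measurableType d) (R : realType)
  (mu : {measure set T -> \bar R}) (D : set T) (g : T -> \bar R).
Context (mD : measurable D).
Context (mg : measurable_fun D g) (g0 : forall x, D x -> 0 <= g x).

(** The proofs of measurability and of non-negativity are arguments, so that the measure structure
    declared below can be inferred from the term alone. *)
Definition density_measure of measurable D & measurable_fun D g
    & (forall x, D x -> 0 <= g x) := fun A : set T =>
  \int[mu]_(x in A `&` D) g x.

Local Notation dens := (density_measure mD mg g0).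

Let dens0 : dens set0 = 0.
Proof. by rewrite /density_measure set0I integral_set0. Qed.

Let dens_ge0 A : 0 <= dens A.
Proof. by apply: integral_ge0 => x [_ /g0]. Qed.

Let dens_sigma_additive : semi_sigma_additive dens.
Proof.
move=> F mF tF mUF; rewrite /density_measure setI_bigcupl.
rewrite ge0_integral_bigcup//=.
- apply: is_cvg_nneseries => k _ _.
  by apply: integral_ge0 => x [_ /g0].
- by move=> k; exact: measurableI.
- apply: measurable_funS mg => //.
  by move=> x [k _ []].
- by move=> x [k _ [_ /g0]].
- apply/trivIsetP => i j _ _ ij.
  rewrite setIACA; move/trivIsetP : tF => /(_ i j Logic.I Logic.I ij) ->.
  by rewrite set0I.
Qed.

HB.instance Definition _ := isMeasure.Build _ _ _ dens
  dens0 dens_ge0 dens_sigma_additive.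

End density_measure.

(** * Couplings built from countably many transport maps *)

Section transport_series.
Local Open Scope ereal_scope.
Context (R : realType).
Local Notation lambda := (@lebesgue_measure R).
Local Notation rT := (measurableTypeR R).

Lemma circle_cost_ge0 (p : R * R) : (0 <= circle_cost p)%R.
Proof. by rewrite /circle_cost le_min !sqr_ge0. Qed.

Lemma measurable_circle : measurable (circle R : set rT).
Proof. exact: measurable_itv. Qed.

Lemma measurable_circle_cost :
  measurable_fun setT (@circle_cost R : rT * rT -> R).
Proof.
have md : measurable_fun setT (fun p : rT * rT => `|p.1 - p.2|%R).
  apply: measurableT_comp => //.
  by apply: measurable_funB; [exact: measurable_fst|exact: measurable_snd].
apply: measurable_minr; apply: measurable_funX => //.
by apply: measurable_funB.
Qed.

(** The coupling is the sum over [k] of the images of the densities [n_ k] under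
    [t |-> (t, T_ k t)]. By [h0] and [h1] its marginals are [mu0] and [mu1], and the [k]-th piece
    costs at most [c_ k] times its mass. *)
Lemma W2sq_le_series (mu0 mu1 : probability rT R)
    (n_ : nat -> R -> \bar R) (T_ : nat -> rT -> rT) (c_ : nat -> R)
    (mn : forall k, measurable_fun (circle R) (n_ k))
    (n0 : forall k t, circle R t -> 0 <= n_ k t)
    (mT : forall k, measurable_fun setT (T_ k))
    (c0 : forall k, (0 <= c_ k)%R)
    (hc : forall k t, circle R t -> (circle_cost (t, T_ k t) <= c_ k)%R)
    (h0 : forall A : set rT, measurable A ->
      \sum_(k <oo) \int[lambda]_(t in A `&` circle R) n_ k t = mu0 A)
    (h1 : forall A : set rT, measurable A ->
      \sum_(k <oo) \int[lambda]_(t in T_ k @^-1` A `&` circle R) n_ k t =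
      mu1 A) :
  W2sq mu0 mu1 <=
  \sum_(k <oo) (c_ k)%:E * \int[lambda]_(t in circle R) n_ k t.
Proof.
have mgr k : measurable_fun setT (fun t : rT => (t, T_ k t)).
  by apply/measurable_fun_pair.
pose kap_ k : {measure set (rT * rT) -> \bar R} :=
  pushforward (density_measure lambda measurable_circle (mn k) (n0 k))
              (fun t : rT => (t, T_ k t)).
pose kap := kap_ mgr.
have mcost : measurable_fun setT (fun p : rT * rT => (circle_cost p)%:E).
  by apply: measurableT_comp => //; exact: measurable_circle_cost.
have cost0 (p : rT * rT) : 0 <= (circle_cost p)%:E.
  by rewrite lee_fin circle_cost_ge0.
have kapE k A : kap k A =
    \int[lambda]_(t in (fun t => (t, T_ k t)) @^-1` A `&` circle R) n_ k t.
  by [].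
have kapT0 A : measurable A -> mseries kap 0 (A `*` setT) = mu0 A.
  move=> mA; rewrite -h0//; apply: eq_eseriesr => k _; rewrite kapE.
  congr (integral _ _ _); congr (_ `&` _).
  by apply/seteqP; split => t /=; [case|].
have kapT1 A : measurable A -> mseries kap 0 (setT `*` A) = mu1 A.
  move=> mA; rewrite -h1//; apply: eq_eseriesr => k _; rewrite kapE.
  congr (integral _ _ _); congr (_ `&` _).
  by apply/seteqP; split => t /=; [case|].
have kapT : mseries kap 0 setT = 1.
  by rewrite -setXTT kapT0// probability_setT.
pose kappa : probability (rT * rT)%type R :=
  HB.pack (mseries kap 0) (Measure_isProbability.Build _ _ R _ kapT).
apply: (@le_trans _ _ (\int[kappa]_p (circle_cost p)%:E)).
  apply: ereal_inf_lbound; exists kappa => // A mA.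
  by split; [exact: kapT0|exact: kapT1].
rewrite [leLHS](ge0_integral_measure_series kap measurableT)//.
apply: lee_nneseries => [k _ _|k _]; first exact: integral_ge0.
have -> : \int[lambda]_(t in circle R) n_ k t = kap k setT.
  by rewrite kapE preimage_setT setTI.
rewrite -integral_cst//.
(* The cost is bounded by [c_ k] only on the graph of [T_ k] over the circle; [kap k] does not
   charge the points where the bound fails, so an almost-everywhere comparison suffices. *)
apply: ae_ge0_le_integral => //.
  by move=> p _; rewrite lee_fin.
exists [set p | (c_ k < circle_cost p)%R]; split.
- rewrite -[X in measurable X]setTI; apply: measurable_fun_ltr => //.
  exact: measurable_circle_cost.
- rewrite kapE (_ : _ `&` _ = set0) ?integral_set0//.
  by apply/seteqP; split => t //= [+ /hc]; rewrite ltNge => /negP.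
- by move=> p /= /not_implyP[_] /negP; rewrite lee_fin -ltNge.
Qed.
End transport_series.

(** * Rotations of the circle and the invariance of Lebesgue measure *)

Section rotation.
Local Open Scope ereal_scope.
Context (R : realType).
Local Notation lambda := (@lebesgue_measure R).
Local Notation rT := (measurableTypeR R).

(** Lebesgue measure is determined by its values on the intervals []a, b]], and a translation pulls
    such an interval back to one of the same length. *)
Lemma lebesgue_measure_addr (c : R) (A : set rT) : measurable A ->
  pushforward lambda ((fun x : R => x + c)%R : rT -> rT) A = lambda A.
Proof.
have mc : measurable_fun [set: rT] ((fun x : R => x + c)%R : rT -> rT).
  by apply: measurable_funD.
move=> mA; apply/esym.
apply: (lebesgue_measure_unique (mu := pushforward lambda _)) => //.
move=> _ [[a b]] _ <-.
rewrite /= /pushforward.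
rewrite (_ : _ @^-1` _ = `](a - c)%R, (b - c)%R]%classic); last first.
  by apply/seteqP; split => x /=; rewrite !in_itv/= ltrBlDr lerBrDr.
rewrite !lebesgue_measure_itv/= !lte_fin ltrD2r -!EFinB.
by congr (if _ then _%:E else _); lra.
Qed.

Lemma ge0_integral_addr (c : R) (D : set rT) (f : R -> \bar R) :
  measurable D -> measurable_fun D f -> (forall x, D x -> 0 <= f x) ->
  \int[lambda]_(x in (fun x : R => x + c)%R @^-1` D) f (x + c)%R =
  \int[lambda]_(x in D) f x.
Proof.
move=> mD mf f0.
have mc : measurable_fun [set: rT] ((fun x : R => x + c)%R : rT -> rT).
  by apply: measurable_funD.
rewrite -[LHS](ge0_integral_pushforward mc lambda)//.
- by apply: eq_measure_integral => A mA _; exact: lebesgue_measure_addr.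
- by move=> x /set_mem /f0.
Qed.

(** Rotation by the angle [s] on representatives in [0, 2pi[. For [0 <= s <= 2 * pi] the sum stays
    below 4pi, so one subtraction of 2pi is enough. *)
Definition rot (s t : R) : R :=
  if (t + s < 2 * pi)%R then (t + s)%R else (t + s - 2 * pi)%R.

Lemma measurable_rot (s : R) : measurable_fun [set: rT] (rot s : rT -> rT).
Proof.
apply: measurable_fun_ifT => /=.
- by apply: measurable_fun_ltr => //; exact: measurable_funD.
- exact: measurable_funD.
- by apply: measurable_funB => //; exact: measurable_funD.
Qed.

Lemma rot_mode (g : R -> R) (s t : R) :
  (forall x, g (x + 2 * pi) = g x)%R -> g (rot s t) = g (t + s)%R.
Proof. by move=> gp; rewrite /rot; case: ifP => // _; rewrite -gp subrK. Qed.

(** Each branch of [rot] matches one term of the minimum: without wrapping the representatives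
    differ by [s], with wrapping by [2 * pi - s], whose complement is [s]. *)
Lemma circle_cost_rot (s t : R) : (0 <= s <= 2 * pi)%R ->
  (circle_cost (t, rot s t) <= s ^+ 2)%R.
Proof.
move=> /andP[s0 s2]; rewrite /circle_cost/= ge_min /rot; case: ifPn => _.
  apply/orP; left.
  rewrite (_ : t - (t + s) = - s)%R; last by ring.
  by rewrite normrN real_normK ?num_real.
apply/orP; right.
rewrite (_ : t - (t + s - 2 * pi) = 2 * pi - s)%R; last lra.
by rewrite ger0_norm ?subr_ge0// subKr.
Qed.

(* Rotation is translation by [s] on [0, 2pi - s[, by [s - 2pi] on the rest. *)
Lemma ge0_integral_rot (s : R) (A : set rT) (f : R -> \bar R) :
  (0 <= s <= 2 * pi)%R ->
  measurable A -> measurable_fun (A `&` circle R) f ->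
  (forall x, (A `&` circle R) x -> 0 <= f x) ->
  \int[lambda]_(x in rot s @^-1` A `&` circle R) f (rot s x) =
  \int[lambda]_(x in A `&` circle R) f x.
Proof.
move=> /andP[s0 s2] mA mf f0.
(* [I1] is the part of the target reached without wrapping, [I2] the part reached after wrapping; on
   the preimage of each, [rot s] is a plain translation. *)
pose I1 : set rT := A `&` `[s, (2 * pi)%R[%classic.
pose I2 : set rT := A `&` `[0%R, s[%classic.
have mI1 : measurable I1 by apply: measurableI => //; exact: measurable_itv.
have mI2 : measurable I2 by apply: measurableI => //; exact: measurable_itv.
have E : A `&` circle R = I1 `|` I2.
  rewrite /I1 /I2 -setIUr; congr (_ `&` _).
  apply/seteqP; split => x /=; rewrite /circle/= !in_itv/=.
    move=> /andP[x0 x2]; rewrite x0 x2/=.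
    by have [xs|xs] := ltP x s; [right|left].
  by move=> [|] /andP[? ?]; apply/andP; split; lra.
have mI12 : measurable (A `&` circle R).
  by rewrite E; exact: measurableU.
have sI1 : I1 `<=` A `&` circle R by rewrite E => x; left.
have sI2 : I2 `<=` A `&` circle R by rewrite E => x; right.
have rotC x : circle R x -> circle R (rot s x).
  rewrite /circle /rot /= !in_itv/= => /andP[x0 x2].
  by case: ifPn; rewrite -?leNgt => h; apply/andP; split; lra.
have E' : rot s @^-1` A `&` circle R =
  (fun x : R => x + s)%R @^-1` I1 `|`
  (fun x : R => x + (s - 2 * pi))%R @^-1` I2.
  apply/seteqP; split => x /=; rewrite /I1 /I2 /rot /circle/= !in_itv/=.
    move=> []; case: ifPn => [h1 Ax /andP[h2 h3]|h1 Ax /andP[h2 h3]].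
      by left; split => //; apply/andP; split; lra.
    right; split; first by rewrite addrA.
    by rewrite -leNgt in h1; apply/andP; split; lra.
  move=> [[Ax /andP[h1 h2]]|[Ax /andP[h1 h2]]].
    by rewrite h2; split => //; apply/andP; split; lra.
  rewrite ifF; last by apply/negbTE; rewrite -leNgt; lra.
  by rewrite -addrA; split => //; apply/andP; split; lra.
have mp (c : R) (B : set rT) : measurable B ->
    measurable ((fun x : R => x + c)%R @^-1` B : set rT).
  move=> mB; rewrite -[X in measurable X]setTI.
  by apply: (measurable_funD _ _ _ mB) => //.
have mr1 : measurable (rot s @^-1` A `&` circle R : set rT).
  by rewrite E'; apply: measurableU; exact: mp.
have mfr : measurable_fun (rot s @^-1` A `&` circle R) (f \o rot s).
  apply: (measurable_comp mI12 _ mf) => //.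
    by move=> _ /= [x [Ax Cx] <-]; split => //; exact: rotC.
  exact: measurable_funTS (measurable_rot s).
have fr0 x : (rot s @^-1` A `&` circle R) x -> 0 <= (f \o rot s) x.
  by move=> [Ax Cx]; apply: f0; split => //; exact: rotC.
rewrite E' ge0_integral_setU//=; last 5 first.
- exact: mp.
- exact: mp.
- by move: mfr; rewrite E'.
- by move=> x xI; apply: fr0; rewrite E'.
- rewrite disj_set2E; apply/eqP/seteqP; split => // x /=.
  by rewrite /I1 /I2/= !in_itv/= => -[[_ /andP[_ h1]] [_ /andP[h2 _]]]; lra.
rewrite E [RHS]ge0_integral_setU//; last 3 first.
- by rewrite -E.
- by rewrite -E.
- rewrite disj_set2E; apply/eqP/seteqP; split => // x /=.
  by rewrite /I1 /I2/= !in_itv/= => -[[_ /andP[h1 _]] [_ /andP[_ h2]]]; lra.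
congr (_ + _).
  rewrite -[RHS](ge0_integral_addr s)//.
  - apply: eq_integral => x /set_mem/= [_ ]; rewrite /= in_itv/= => /andP[_ h].
    by rewrite /rot h.
  - exact: measurable_funS mf.
  - by move=> x /sI1/f0.
rewrite -[RHS](ge0_integral_addr (s - 2 * pi))//.
- apply: eq_integral => x /set_mem/= [_ ]; rewrite /= in_itv/= => /andP[h _].
  by rewrite /rot ifF ?addrA//; apply/negbTE; rewrite -leNgt; lra.
- exact: measurable_funS mf.
- by move=> x /sI2/f0.
Qed.
End rotation.

(** * Trigonometric modes: derivatives, integrals and half-period symmetry *)

Section dilation.
Context (R : realType).

Lemma continuous_dilation (phi : R -> R) (c : R) : continuous phi ->
  continuous (fun t : R => phi (c * t)).
Proof.
move=> cphi t.
apply: (@cvg_comp _ _ _ (fun t : R => c * t) phi _ (nbhs (c * t))).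
  exact: mulrl_continuous.
exact: cphi.
Qed.

Lemma is_derive_cos_dilation (c t : R) : c != 0 ->
  is_derive t (1 : R) (fun t : R => - cos (c * t) / c) (sin (c * t)).
Proof.
move=> c0.
have dc : is_derive t (1 : R) (fun t : R => c * t) c.
  by apply: is_derive_eq; rewrite ?scaler0 ?add0r ?addr0 -?[LHS]/(c * 1) mulr1.
have dcos := @is_derive1_comp _ cos _ t _ _ (is_derive_cos (c * t)) dc.
have -> : (fun t : R => - cos (c * t) / c) =
    - c^-1 \*: (cos \o (fun t : R => c * t)).
  by apply/funext => x /=; rewrite mulNr mulrC -mulNr.
by apply: is_derive_eq; rewrite -[LHS]/(_ * _); field.
Qed.

End dilation.

Section trigonometric_modes.
Local Open Scope ereal_scope.
Context (R : realType).
Local Notation lambda := (@lebesgue_measure R).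
Local Notation rT := (measurableTypeR R).

(** Induction on [n]: the first period is split off and the rest is translated back by [s]. *)
Lemma ge0_integral_periodic (s : R) (h : R -> \bar R) (n : nat) :
  (0 <= s)%R -> measurable_fun [set: rT] h -> (forall x, 0 <= h x) ->
  (forall x, h (x + s)%R = h x) ->
  \int[lambda]_(x in `[0%R, (n%:R * s)%R[) h x =
  n%:R%:E * \int[lambda]_(x in `[0%R, s[) h x.
Proof.
move=> s0 mh h0 hp; elim: n => [|n ih].
  by rewrite !mul0r mul0e set_itvco0 integral_set0.
have ns0 : (0 <= n%:R * s)%R by rewrite mulr_ge0.
have E : `[0%R, (n.+1%:R * s)%R[%classic =
    `[0%R, s[%classic `|` `[s, (n.+1%:R * s)%R[%classic.
  apply/seteqP; split => x /=; rewrite !in_itv/= -natr1 mulrDl mul1r.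
    move=> /andP[x0 xn]; rewrite x0 xn/=.
    by have [xs|xs] := ltP x s; [left|right].
  by move=> [|] /andP[? ?]; apply/andP; split; lra.
rewrite E ge0_integral_setU//=; last 2 first.
- exact: measurable_funTS.
- rewrite disj_set2E; apply/eqP/seteqP; split => // x /=.
  by rewrite !in_itv/= => -[/andP[_ h1] /andP[h2 _]]; lra.
rewrite -[X in _ + X](ge0_integral_addr s)//; last exact: measurable_funTS.
rewrite (_ : _ @^-1` _ = `[0%R, (n%:R * s)%R[%classic); last first.
  apply/seteqP; split => x /=; rewrite !in_itv/= -natr1 mulrDl mul1r.
    by move=> /andP[? ?]; apply/andP; split; lra.
  by move=> /andP[? ?]; apply/andP; split; lra.
have -> : (fun x : rT => h (x + s)%R) = h by apply/funext => x; exact: hp.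
by rewrite ih -natr1 EFinD ge0_muleDl ?lee_fin// mul1e addeC.
Qed.

(** The sine is non-negative on this arch, so the absolute value drops. Closing the interval changes
    no integral and lets the fundamental theorem of calculus apply to the antiderivative
    [- cos (k t) / k]. *)
Lemma integral_abs_sin_arch (k : nat) : (0 < k)%N ->
  \int[lambda]_(t in `[0%R, (pi / k%:R)%R[) `|sin (k%:R * t)|%:E =
  (2 / k%:R)%:E.
Proof.
move=> k0; have k0R : (0 < k%:R :> R)%R by rewrite ltr0n.
have pk : (0 < pi / k%:R :> R)%R by rewrite divr_gt0// pi_gt0.
have cs : continuous (fun t : R => sin (k%:R * t))%R.
  exact: continuous_dilation (@continuous_sin R).
rewrite integral_itv_bndo_bndc; last first.
  apply: measurable_funTS; apply/measurable_EFinP.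
  by apply: measurableT_comp => //; exact: continuous_measurable_fun.
transitivity (\int[lambda]_(t in `[0%R, (pi / k%:R)%R]) (sin (k%:R * t))%:E).
  apply: eq_integral => t /set_mem/=; rewrite in_itv/= => /andP[t0 tk].
  rewrite ger0_norm// sin_ge0_pi// (mulr_ge0 (ltW k0R) t0)/=.
  by rewrite mulrC -ler_pdivlMr.
pose F (t : R) : R := (- cos (k%:R * t) / k%:R)%R.
have dF t : is_derive t (1%R : R) F (sin (k%:R * t)).
  by apply: is_derive_cos_dilation; rewrite gt_eqF.
rewrite (@continuous_FTC2 _ _ F)//.
- rewrite /F mulr0 cos0 mulrCA divff ?gt_eqF// mulr1 cospi -EFinB.
  by congr _%:E; field; rewrite gt_eqF.
- exact: continuous_subspaceT.
- have cF : continuous F.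
    by move=> t; apply/differentiable_continuous/derivable1_diffP.
  split => //.
  + by apply: cvg_at_right_filter; exact: cF.
  + by apply: cvg_at_left_filter; exact: cF.
- by move=> t _; rewrite derive1E; exact: derive_val.
Qed.

Lemma integral_abs_sin (k : nat) : (0 < k)%N ->
  \int[lambda]_(t in circle R) `|sin (k%:R * t)|%:E = 4%:E.
Proof.
move=> k0; have k0R : (k%:R != 0 :> R)%R by rewrite pnatr_eq0 -lt0n.
(* The circle consists of [2 * k] arches of length [pi / k], a period of the absolute value, each
   contributing [2 / k]. *)
rewrite /circle (_ : 2 * pi = (2 * k)%N%:R * (pi / k%:R))%R; last first.
  by rewrite natrM; field.
rewrite ge0_integral_periodic.
- by rewrite integral_abs_sin_arch// -EFinM natrM; congr _%:E; field.
- by rewrite divr_ge0// pi_ge0.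
- apply/measurable_EFinP.
  apply: measurableT_comp => //; apply: continuous_measurable_fun.
  exact: continuous_dilation (@continuous_sin R).
- by [].
- move=> x; congr _%:E.
  by rewrite mulrDr (mulrC _ (pi / _))%R divfK// sinDpi normrN.
Qed.

(** Rotating by a quarter period [pi / (2 * k)] turns the sine mode into the cosine mode, and
    rotations preserve integrals over the circle. *)
Lemma integral_abs_cos (k : nat) : (0 < k)%N ->
  \int[lambda]_(t in circle R) `|cos (k%:R * t)|%:E = 4%:E.
Proof.
move=> k0; have k0R : (k%:R != 0 :> R)%R by rewrite pnatr_eq0 -lt0n.
have sp : (0 <= (pi : R) / (2 * k%:R) <= 2 * pi)%R.
  apply/andP; split; first by rewrite divr_ge0 ?pi_ge0.
  rewrite ler_pdivrMr ?mulr_gt0 ?ltr0n//.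
  have : (1 <= k%:R :> R)%R by rewrite ler1n.
  have := pi_gt0 R; nra.
rewrite -(integral_abs_sin k0) -[circle R]setTI.
rewrite -[RHS](ge0_integral_rot sp measurableT)//; last first.
  apply: measurable_funTS; apply/measurable_EFinP.
  apply: measurableT_comp => //; apply: continuous_measurable_fun.
  exact: continuous_dilation (@continuous_sin R).
rewrite preimage_setT; apply: eq_integral => t _; congr _%:E.
rewrite (rot_mode (g := fun t => `|sin (k%:R * t)|%R)).
  rewrite mulrDr (_ : k%:R * (pi / (2 * k%:R)) = pi / 2)%R; last by field.
  by rewrite sinD cos_pihalf sin_pihalf mulr0 mulr1 add0r.
move=> x; rewrite mulrDr (_ : k%:R * (2 * pi) = pi *+ (2 * k))%R; last first.
  by rewrite -[RHS]mulr_natl natrM; ring.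
by rewrite (alternatingn (@sinDpi R)) normrM normrX normrN1 expr1n mul1r.
Qed.

(** Advancing [t] by [pi / k] advances the argument of [phi] by [pi] and flips its sign, which
    exchanges the two parts. Wrapping is harmless because an alternating function has period
    [2 * pi]. *)
Lemma funrneg_mode_rot (phi : R -> R) (c : R) (k : nat) (t : R) :
  (0 < k)%N -> alternating phi pi ->
  ((fun u => c * phi (k%:R * u))^\- t =
   (fun u => c * phi (k%:R * u))^\+ (rot (pi / k%:R) t))%R.
Proof.
move=> k0 phiN; have k0R : (k%:R != 0 :> R)%R by rewrite pnatr_eq0 -lt0n.
rewrite rot_mode => [|x].
  by rewrite /funrneg /funrpos mulrDr (mulrC _ (pi / _))%R divfK// phiN mulrN.
rewrite /funrpos mulrDr (_ : k%:R * (2 * pi) = pi *+ 2 *+ k)%R; last first.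
  by rewrite -mulrnA -[RHS]mulr_natl natrM; ring.
rewrite (@periodicn _ _ phi)// => u.
by rewrite mulr2n addrA !phiN opprK.
Qed.

(* The two parts of a mode are exchanged by a half-period rotation, so each
   carries half of the integral of the absolute value. *)
Lemma integral_funrneg_mode (phi : R -> R) (c : R) (k : nat) :
  (0 < k)%N -> continuous phi -> alternating phi pi ->
  \int[lambda]_(t in circle R) `|phi (k%:R * t)|%:E = 4%:E ->
  \int[lambda]_(t in circle R) ((fun u => c * phi (k%:R * u))%R^\- t)%:E =
  (2 * `|c|)%:E.
Proof.
move=> k0 cphi phiN phi4.
pose g (u : R) := (c * phi (k%:R * u))%R.
have mphi : measurable_fun [set: rT] (fun u : rT => phi (k%:R * u)%R).
  by apply: continuous_measurable_fun; exact: continuous_dilation.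
have mg : measurable_fun [set: rT] g by apply: measurable_funM.
have mp : measurable_fun (circle R) (fun t => (g^\+%R t)%:E).
  by apply: measurable_funTS; apply/measurable_EFinP/measurable_funrpos.
have mn : measurable_fun (circle R) (fun t => (g^\-%R t)%:E).
  by apply: measurable_funTS; apply/measurable_EFinP/measurable_funrneg.
have sp : (0 <= (pi : R) / k%:R <= 2 * pi)%R.
  apply/andP; split; first by rewrite divr_ge0 ?pi_ge0.
  rewrite ler_pdivrMr ?ltr0n//.
  have : (1 <= k%:R :> R)%R by rewrite ler1n.
  have := pi_gt0 R; nra.
have np : \int[lambda]_(t in circle R) (g^\-%R t)%:E =
          \int[lambda]_(t in circle R) (g^\+%R t)%:E.
  rewrite -[circle R]setTI.
  rewrite -[RHS](ge0_integral_rot sp measurableT); last 2 first.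
  - by rewrite setTI.
  - by move=> x _; rewrite lee_fin.
  rewrite preimage_setT; apply: eq_integral => t _.
  by rewrite /g funrneg_mode_rot.
have : \int[lambda]_(t in circle R) (g^\-%R t)%:E +
       \int[lambda]_(t in circle R) (g^\-%R t)%:E = (4 * `|c|)%:E.
  rewrite [X in _ + X = _]np -ge0_integralD//=; last 3 first.
  - exact: measurable_circle.
  - by move=> t _; rewrite lee_fin.
  - by move=> t _; rewrite lee_fin.
  rewrite mulrC EFinM -phi4 -ge0_integralZl_EFin//=.
  - apply: eq_integral => t _; rewrite -EFinD -EFinM -normrM addrC.
    by rewrite -[RHS]/((Num.norm \o g)%R t)%:E -funrposDneg.
  - exact: measurable_circle.
  - by apply: measurable_funTS; apply/measurable_EFinP; apply: measurableT_comp.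
have : 0 <= \int[lambda]_(t in circle R) (g^\-%R t)%:E.
  by apply: integral_ge0 => t _; rewrite lee_fin.
(* Infinite values must be ruled out before the equation for twice the integral can be halved. *)
case: (\int[lambda]_(t in _) _) => [r| |]//= _ [] rr.
by congr _%:E; lra.
Qed.

End trigonometric_modes.

(** * Recovering both densities from the common part at a point *)

Section series_parts.
Local Open Scope ereal_scope.
Context (R : realType).

(* Only the termwise difference of the two series is known to converge. *)
Lemma nneseries_parts (x y : R) (u v : nat -> R) :
  (forall k, 0 <= u k)%R -> (forall k, 0 <= v k)%R ->
  (fun n => x + \sum_(1 <= k < n.+1) (u k - v k))%R @ \oo --> y ->
  0 <= x%:E - \sum_(1 <= k <oo) (v k)%:E ->
  x%:E - \sum_(1 <= k <oo) (v k)%:E + \sum_(1 <= k <oo) (v k)%:E = x%:E /\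
  x%:E - \sum_(1 <= k <oo) (v k)%:E + \sum_(1 <= k <oo) (u k)%:E = y%:E.
Proof.
move=> u0 v0 uvy; set V := \sum_(1 <= k <oo) (v k)%:E => xV.
have V0 : 0 <= V by apply: nneseries_ge0 => k _ _; rewrite lee_fin.
have cV : (fun n => \sum_(1 <= k < n) (v k)%:E) @ \oo --> V.
  by apply: is_cvg_nneseries => k _ _; rewrite lee_fin.
(* An infinite [V] would make [x - V] equal to [-oo], against [xV]. So the series of [v] converges,
   and that of [u] does too, since [u k = (u k - v k) + v k]. *)
case: V V0 xV cV => [r| |]// _ xV cV.
split; first by rewrite -EFinB -EFinD subrK.
have cv : (fun n => \sum_(1 <= k < n.+1) v k)%R @ \oo --> r.
  rewrite (cvg_shiftS (fun n => \sum_(1 <= k < n) v k)%R).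
  by move: cV; under eq_fun do rewrite sumEFin; move=> /fine_cvgP[].
have cu : (fun n => \sum_(1 <= k < n.+1) u k)%R @ \oo --> (y - x + r)%R.
  rewrite (_ : (fun n => _) = (fun n =>
      (x + \sum_(1 <= k < n.+1) (u k - v k)) - x + \sum_(1 <= k < n.+1) v k))%R.
    by apply: cvgD => //; apply: cvgB => //; exact: cvg_cst.
  by apply/funext => n; rewrite sumrB; ring.
rewrite (_ : \sum_(1 <= k <oo) (u k)%:E = (y - x + r)%:E).
  by rewrite -EFinB -EFinD; congr _%:E; ring.
apply/cvg_lim => //.
under eq_fun do rewrite sumEFin.
apply/fine_cvgP; split; first exact: nearW.
by rewrite -(cvg_shiftS (fun n => \sum_(1 <= k < n) u k)%R).
Qed.

End series_parts.

(** * Sign and measurability of the density of nu *)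

Section nonnegative_density.
Local Open Scope ereal_scope.
Context (R : realType).
Local Notation lambda := (@lebesgue_measure R).
Local Notation rT := (measurableTypeR R).

(** Test the hypothesis on the set [A] where [g < 0]. The integral there is both non-negative and
    non-positive, so [g] vanishes almost everywhere on [A], which forces [A] to be null. *)
Lemma nonneg_circle_measure_ae (g : R -> \bar R) :
  measurable_fun (circle R : set rT) g -> nonneg_circle_measure g ->
  {ae lambda, forall t, circle R t -> 0 <= g t}.
Proof.
move=> mg hg; pose A : set rT := circle R `&` [set t | g t < 0].
have mA : measurable A.
  by apply: emeasurable_fun_infty_o => //; exact: measurable_circle.
have mgA : measurable_fun A g.
  exact: measurable_funS (@measurable_circle R) (@subIsetl _ _ _) mg.
have gA t : A t -> g t < 0 by case.
have := hg A mA (@subIsetl _ _ _).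
(* The constant sign on [A] lets the minus sign be pulled out without integrability; [g] may take
   the value [-oo]. *)
have -> : \int[lambda]_(t in A) g t = - \int[lambda]_(t in A) - g t.
  rewrite -integral_ge0N; last by move=> t /gA/ltW; rewrite oppe_ge0.
  by apply: eq_integral => t _; rewrite oppeK.
rewrite oppe_ge0 => gN.
have : \int[lambda]_(t in A) `|g t| = 0.
  apply/eqP; rewrite eq_le integral_ge0// andbT (le_trans _ gN)//.
  rewrite le_eqVlt; apply/orP; left; apply/eqP.
  by apply: eq_integral => t /set_mem/gA/ltW/lee0_abs.
move/(ae_eq_integral_abs _ mA mgA) => g0.
apply: filterS g0 => t g0 Ct; rewrite leNgt; apply/negP => gt.
by move: (gt); rewrite g0 ?ltxx//; split.
Qed.

Lemma measurable_cos_mode (a : nat -> R) (k : nat) (D : set rT) :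
  measurable_fun D (cos_mode a k).
Proof.
apply: measurable_funTS; apply: measurable_funM => //.
apply: continuous_measurable_fun.
exact: continuous_dilation (@continuous_cos R).
Qed.

Lemma measurable_sin_mode (a : nat -> R) (k : nat) (D : set rT) :
  measurable_fun D (sin_mode a k).
Proof.
apply: measurable_funTS; apply: measurable_funM => //.
apply: continuous_measurable_fun.
exact: continuous_dilation (@continuous_sin R).
Qed.

Lemma measurable_nu_density (f0 : R -> R) (a b : nat -> R) :
  measurable_fun (circle R : set rT) f0 ->
  measurable_fun (circle R : set rT) (nu_density f0 a b).
Proof.
move=> mf0; apply: emeasurable_funB; first exact/measurable_EFinP.
under eq_fun do rewrite eseries_cond.
apply: ge0_emeasurable_sum => [k t _ _|k _].
  by rewrite lee_fin addr_ge0.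
apply/measurable_EFinP; apply: measurable_funD; apply: measurable_funrneg.
  exact: measurable_cos_mode.
exact: measurable_sin_mode.
Qed.
End nonnegative_density.

(** * Restriction to the fundamental domain *)

Section circle_restriction.
Local Open Scope ereal_scope.
Context (R : realType).
Local Notation lambda := (@lebesgue_measure R).
Local Notation rT := (measurableTypeR R).

Lemma rot0 (t : R) : circle R t -> rot 0 t = t.
Proof. by rewrite /circle/rot/= in_itv/= addr0 => /andP[_ ->]. Qed.

(** The measure does not charge the complement of the circle, so cutting [A] down to the circle
    keeps its measure. *)
Lemma setI_circle_density (mu : probability rT R) (f : R -> R) (A : set rT) :
  ac_circle_probability mu -> circle_density mu f -> measurable A ->
  \int[lambda]_(t in A `&` circle R) (f t)%:E = mu A.
Proof.
move=> [muC _] [_ muf] mA; have mC := @measurable_circle R.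
rewrite -muf; [|exact: measurableI|exact: subIsetr].
rewrite [RHS](measureDI mu mA mC) [X in _ = X + _](_ : _ = 0) ?add0e//.
apply: (subset_measure0 _ _ _ muC); last by move=> t [].
- exact: measurableD.
- exact: measurableC.
Qed.

End circle_restriction.

(** * Assembling the pieces into the transport bound *)

Theorem theorem6 (R : realType)
    (mu0 mu1 : probability (measurableTypeR R) R)
    (f0 f1 : R -> R) (a b : nat -> R)
    (hmu0 : ac_circle_probability mu0) (hmu1 : ac_circle_probability mu1)
    (hf0 : circle_density mu0 f0) (hf1 : circle_density mu1 f1)
    (hseries : {ae @lebesgue_measure R, forall t : R, circle R t ->
       (fun n : nat => f0 t + \sum_(1 <= k < n.+1)
          (a k * cos (k%:R * t) + b k * sin (k%:R * t))) @ \oo --> f1 t})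
    (hnu : nonneg_circle_measure (nu_density f0 a b)) :
  (W2sq mu0 mu1 <=
   \sum_(1 <= k <oo) (2 * pi ^+ 2 / k%:R ^+ 2 * (`|a k| + `|b k|))%:E)%E.
Proof.
have aeF := ae_filter_ringOfSetsType (@lebesgue_measure R).
have mC := @measurable_circle R.
pose rT := measurableTypeR R.
pose u k t := (cos_mode a k)^\+ t + (sin_mode b k)^\+ t.
pose v k t := (cos_mode a k)^\- t + (sin_mode b k)^\- t.
have u0 k t : 0 <= u k t by rewrite addr_ge0.
have v0 k t : 0 <= v k t by rewrite addr_ge0.
have mu_ k : measurable_fun [set: rT] (u k).
  by apply: measurable_funD; apply: measurable_funrpos;
    [exact: measurable_cos_mode|exact: measurable_sin_mode].
have mv k : measurable_fun [set: rT] (v k).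
  by apply: measurable_funD; apply: measurable_funrneg;
    [exact: measurable_cos_mode|exact: measurable_sin_mode].
have mf0 : measurable_fun (circle R : set rT) (EFin \o f0).
  exact: measurable_int hf0.1.
have mnu : measurable_fun (circle R : set rT) (nu_density f0 a b).
  by apply: measurable_nu_density; exact/measurable_EFinP.
(* The density is non-negative only almost everywhere; truncation at 0 makes it so everywhere and
   alters it only on a null subset of the circle. *)
pose nu t := maxe (nu_density f0 a b t) 0%E.
have mnup : measurable_fun (circle R : set rT) nu.
  by apply: measurable_maxe => //; exact: measurable_cst.
(* Index 0 carries the mass left in place: as [pi / 0 = 0], its rotation is the
   identity and its cost is zero. *)
pose n_ k t := if k is 0%N then nu t else (v k t)%:E.
pose p_ k t := if k is 0%N then nu t else (u k t)%:E.
have nu0 t : (0 <= nu t)%E by rewrite le_max lexx orbT.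
have n0 k t : (0 <= n_ k t)%E by case: k => [|k]//=; rewrite lee_fin.
have p0 k t : (0 <= p_ k t)%E by case: k => [|k]//=; rewrite lee_fin.
have mn k : measurable_fun (circle R : set rT) (n_ k).
  by case: k => [//|k]; apply: measurable_funTS; apply/measurable_EFinP.
have mp k : measurable_fun (circle R : set rT) (p_ k).
  by case: k => [//|k]; apply: measurable_funTS; apply/measurable_EFinP.
have shift k : 0 <= (pi : R) / k%:R <= 2 * pi.
  have p_gt0 := pi_gt0 R.
  case: k => [|k]; first by rewrite invr0 mulr0 lexx/= mulr_ge0// pi_ge0.
  apply/andP; split; first by rewrite divr_ge0 ?pi_ge0.
  rewrite ler_pdivrMr ?ltr0n//.
  have : 1 <= k.+1%:R :> R by rewrite ler1n.
  by nra.
have np k t : circle R t -> n_ k t = p_ k (rot (pi / k%:R) t).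
  case: k => [|k] Ct; first by rewrite invr0 mulr0 rot0.
  rewrite /n_ /p_ /u /v; congr (_ + _)%:E; apply: funrneg_mode_rot => //.
    exact: cosDpi.
  exact: sinDpi.
(* At almost every point, [nu] plus the negative parts gives [f0], and [nu] plus the positive parts
   gives [f1]. *)
have sums : {ae @lebesgue_measure R, forall t, circle R t ->
    (\sum_(k <oo) n_ k t = (f0 t)%:E)%E /\ (\sum_(k <oo) p_ k t = (f1 t)%:E)%E}.
  have hae := nonneg_circle_measure_ae mnu hnu.
  apply: filterS2 hseries hae => t ht nut Ct.
  rewrite !nneseries_recl// /n_ /p_ /nu.
  have E (w : nat -> R -> R) : (\sum_(1 <= k <oo)
      (if k is 0%N then maxe (nu_density f0 a b t) 0 else (w k t)%:E) =
      \sum_(1 <= k <oo) (w k t)%:E)%E.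
    by rewrite eseries_cond [RHS]eseries_cond; apply: eq_eseriesr => -[].
  rewrite !E (max_idPl (nut Ct)).
  apply: (nneseries_parts (u := u ^~ t) (v := v ^~ t)) => //; last exact: nut.
  rewrite (_ : (fun n => _) = (fun n => f0 t + \sum_(1 <= k < n.+1)
    (a k * cos (k%:R * t) + b k * sin (k%:R * t)))); first exact: ht.
  apply/funext => n; congr (_ + _); apply: eq_bigr => k _.
  rewrite /u /v opprD addrACA.
  by congr (_ + _); rewrite -[LHS]/((_ - _) t) funrposBneg.
(* Exchanging sum and integral of non-negative functions turns the pointwise identities into
   identities of measures, once for each marginal. *)
have sumI (q : nat -> R -> \bar R) f (mu : probability rT R) (A : set rT) :
    (forall k t, 0 <= q k t)%E ->
    (forall k, measurable_fun (circle R : set rT) (q k)) ->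
    {ae @lebesgue_measure R, forall t, circle R t ->
      (\sum_(k <oo) q k t = (f t)%:E)%E} ->
    ac_circle_probability mu -> circle_density mu f -> measurable A ->
    (\sum_(k <oo) \int[@lebesgue_measure R]_(t in A `&` circle R) q k t =
     mu A)%E.
  move=> q0 mq qf hmu hf mA.
  have mAC : measurable (A `&` circle R) by exact: measurableI.
  rewrite -(setI_circle_density hmu hf mA) -integral_nneseries//; last first.
    by move=> k; apply: measurable_funS (mq k).
  apply: ae_eq_integral => //.
  - apply: (ge0_emeasurable_sum (P := xpredT)) => // k _.
    by apply: measurable_funS (mq k).
  - by apply: measurable_funS (measurable_int _ hf.1).
  - by apply: filterS qf => t qf [_ Ct]; exact: qf.
have := @W2sq_le_series R mu0 mu1 n_ (fun k => rot (pi / k%:R))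
  (fun k => (pi / k%:R) ^+ 2) mn (fun k t _ => n0 k t)
  (fun k => measurable_rot _) (fun k => sqr_ge0 _)
  (fun k t _ => circle_cost_rot t (shift k)).
move=> /(_ _ _)/le_trans; apply.
- move=> A mA; apply: (sumI n_ f0) => //.
  by apply: filterS sums => t nf Ct; case: (nf Ct).
(* For the second marginal, the rotation by [pi / k] carries the density [n_ k] to [p_ k]. *)
- move=> A mA; rewrite -(sumI p_ f1)//; last first.
    by apply: filterS sums => t nf Ct; case: (nf Ct).
  apply: eq_eseriesr => k _.
  rewrite -[RHS](ge0_integral_rot (shift k))//; last first.
    by apply: measurable_funS (mp k) => //.
  by apply: eq_integral => t /set_mem[_ Ct]; exact: np.
(* The stationary piece, at index 0, has cost 0 and drops out whatever its mass. *)
rewrite nneseries_recl//; last first.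
  by move=> k _; rewrite mule_ge0 ?lee_fin ?sqr_ge0 ?integral_ge0.
rewrite invr0 mulr0 expr0n/= mul0e add0e.
rewrite eseries_cond [leRHS]eseries_cond.
apply: lee_nneseries => [k _ _|k /andP[_ k0]].
  by rewrite mule_ge0 ?lee_fin ?sqr_ge0 ?integral_ge0.
(* With this mass, [(pi / k) ^ 2] times it is exactly the [k]-th term of the bound. *)
have vE : (\int[@lebesgue_measure R]_(t in circle R) n_ k t =
    (2 * (`|a k| + `|b k|))%:E)%E.
  case: k k0 => // k k0.
  transitivity (\int[@lebesgue_measure R]_(t in circle R)
    (((cos_mode a k.+1)^\- t)%:E + ((sin_mode b k.+1)^\- t)%:E))%E => //.
  rewrite ge0_integralD//=.
  - rewrite mulrDr EFinD; congr (_ + _)%E; apply: integral_funrneg_mode => //.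
    + exact: continuous_cos.
    + exact: cosDpi.
    + exact: integral_abs_cos.
    + exact: continuous_sin.
    + exact: sinDpi.
    + exact: integral_abs_sin.
  - by move=> t _; rewrite lee_fin.
  - by apply/measurable_EFinP/measurable_funrneg; exact: measurable_cos_mode.
  - by move=> t _; rewrite lee_fin.
  - by apply/measurable_EFinP/measurable_funrneg; exact: measurable_sin_mode.
rewrite vE -EFinM lee_fin le_eqVlt; apply/orP; left; apply/eqP.
by field; rewrite pnatr_eq0 -lt0n.
Qed.
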